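(* Let $R$ be a semiprime ring and let $e\in R$ be a nonzero idempotent. Then the following are equivalent: (1) $R$ is right $e$-reversible; (2) $R$ is right $e$-reduced; (3) $R$ is $e$-symmetric; (4) $R$ is right $e$-semicommutative.
   Context: All rings are associative with identity. Let $N(R)$ denote the set of nilpotent elements of $R$. For a nonzero idempotent $e\in R$: $R$ is right $e$-reversible if for all $a,b\in R$, $ab=0$ implies $bae=0$; $R$ is right $e$-reduced if $N(R)e=0$; $R$ is $e$-symmetric if for all $a,b,c\in R$, $abc=0$ implies $acbe=0$; $R$ is right $e$-semicommutative if for all $a,b\in R$, $ab=0$ implies $aRbe=0$. *)

(* Defs.v *)
From HB Require Import structures.
From mathcomp Require Import all_boot all_algebra.

Set Implicit Arguments.
Unset Strict Implicit.
Unset Printing Implicit Defensive.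

Import GRing.Theory.
Local Open Scope ring_scope.

(* pzRingType is used so that no nontriviality is built into the carrier; a
   ring with a nonzero idempotent is automatically nontrivial. *)

Definition idempotent_elt (R : pzRingType) (e : R) : Prop := e * e = e.

Definition nilpotent_elt (R : pzRingType) (a : R) : Prop :=
  exists2 n : nat, (0 < n)%N & a ^+ n = 0.

(* Elementwise definition: aRa = 0 implies a = 0. *)
Definition semiprime (R : pzRingType) : Prop :=
  forall a : R, (forall r : R, a * r * a = 0) -> a = 0.

(* The definitions below are intended for a nonzero idempotent e; that
   hypothesis is not part of the predicates. *)

Definition right_e_reversible (R : pzRingType) (e : R) : Prop :=
  forall a b : R, a * b = 0 -> b * a * e = 0.

Definition right_e_reduced (R : pzRingType) (e : R) : Prop :=
  forall a : R, nilpotent_elt a -> a * e = 0.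

Definition e_symmetric (R : pzRingType) (e : R) : Prop :=
  forall a b c : R, a * b * c = 0 -> a * c * b * e = 0.

Definition right_e_semicommutative (R : pzRingType) (e : R) : Prop :=
  forall a b : R, a * b = 0 -> forall r : R, a * r * b * e = 0.

(* Main.v *)
(* In a semiprime ring each of (1) and (4) gives a r a e = 0, hence a e = 0,
   whenever a^2 = 0.  Applied to (1 - e) r e this yields r e = e r e, so
   {x | x e = 0} is a two-sided ideal, and it is completely semiprime
   (x^2 in it implies x in it).  Modulo a completely semiprime ideal, factors of
   a vanishing product may be permuted, which gives the other conditions. *)
Require Import Defs.
From HB Require Import structures.
From mathcomp Require Import all_boot all_algebra.

Import GRing.Theory.

Local Open Scope ring_scope.

(** The pivot through which conditions (1), (2) and (4) are each exploited. *)
Definition right_kills_square_zero (R : pzRingType) (e : R) : Prop :=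
  forall a : R, a * a = 0 -> a * e = 0.

(** Semiprimeness is applied to [a * e]: the product [(a * e) * r * (a * e)] is an instance of the
    hypothesis with [e * r] in the middle. *)
Lemma semiprime_kills_square_zero (R : pzRingType) (e : R) :
    semiprime R -> (forall a r : R, a * a = 0 -> a * r * a * e = 0) ->
  right_kills_square_zero R e.
Proof.
move=> hR H a aa0; apply: hR => r.
by rewrite -(mulrA a e r) mulrA H.
Qed.

Lemma reversible_kills_square_zero (R : pzRingType) (e : R) :
  semiprime R -> right_e_reversible e -> right_kills_square_zero R e.
Proof.
move=> hR H; apply: semiprime_kills_square_zero => // a r aa0.
by apply: H; rewrite mulrA aa0 mul0r.
Qed.

Lemma semicommutative_kills_square_zero (R : pzRingType) (e : R) :
  semiprime R -> right_e_semicommutative e -> right_kills_square_zero R e.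
Proof.
by move=> hR H; apply: semiprime_kills_square_zero => // a r aa0; apply: H.
Qed.

Lemma reduced_kills_square_zero (R : pzRingType) (e : R) :
  right_e_reduced e -> right_kills_square_zero R e.
Proof. by move=> H a aa0; apply: H; exists 2; rewrite // expr2. Qed.

(** [b * a] squares to [b * (a * b) * a = 0]. *)
Lemma kills_square_zero_reversible (R : pzRingType) (e : R) :
  right_kills_square_zero R e -> right_e_reversible e.
Proof.
move=> H a b ab0; apply: H.
by rewrite mulrA -(mulrA b a b) ab0 mulr0 mul0r.
Qed.

Section KillsSquareZero.

Variables (R : pzRingType) (e : R).
Hypotheses (he : idempotent_elt e) (H : right_kills_square_zero R e).

Lemma kills_square_zero_semicentral (r : R) : e * r * e = r * e.
Proof.
have ee : e * (1 - e) = 0 by rewrite mulrBr mulr1 he subrr.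
have : (1 - e) * r * e * e = 0.
  by apply: H; rewrite !mulrA -(mulrA _ e (1 - e)) ee mulr0 !mul0r.
by rewrite -mulrA he !mulrBl mul1r => /eqP; rewrite subr_eq0 => /eqP.
Qed.

Lemma annihilator_mulr (x r : R) : x * e = 0 -> x * r * e = 0.
Proof.
by move=> xe0; rewrite -mulrA -kills_square_zero_semicentral !mulrA xe0 !mul0r.
Qed.

Lemma annihilator_mull (x r : R) : x * e = 0 -> r * x * e = 0.
Proof. by move=> xe0; rewrite -mulrA xe0 mulr0. Qed.

(** Since [e * x * e = x * e], the square of [x * e] is [x * x * e]. *)
Lemma annihilator_sqr (x : R) : x * x * e = 0 -> x * e = 0.
Proof.
move=> xxe0; have : x * e * e = 0.
  by apply: H; rewrite -mulrA (mulrA e) kills_square_zero_semicentral mulrA.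
by rewrite -mulrA he.
Qed.

Lemma annihilator_swap (x y : R) : x * y * e = 0 -> y * x * e = 0.
Proof.
move=> xye0; apply: annihilator_sqr; rewrite !mulrA.
by apply: annihilator_mulr; rewrite -(mulrA y x y); apply: annihilator_mull.
Qed.

(** The square of [x * r * y] contains the factor [y * x], which lies in the ideal by swapping. *)
Lemma annihilator_insert (x y r : R) : x * y * e = 0 -> x * r * y * e = 0.
Proof.
move=> /annihilator_swap yxe0; apply: annihilator_sqr; rewrite !mulrA.
do 2 apply: annihilator_mulr.
by rewrite -(mulrA _ y x); apply: annihilator_mull.
Qed.

Lemma kills_square_zero_reduced : right_e_reduced e.
Proof.
move=> a [[//|n] _ an0].
have {an0} : a ^+ n.+1 * e = 0 by rewrite an0 mul0r.
elim: n => [|n IHn] an0; first by rewrite expr1 in an0.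
(* The square of [a ^+ n.+1] is [a ^+ n * a ^+ n.+2], a multiple of the power already in the
   ideal. *)
apply: IHn; apply: annihilator_sqr.
by rewrite -exprD addSnnS exprD; apply: annihilator_mull.
Qed.

Lemma kills_square_zero_symmetric : e_symmetric e.
Proof.
move=> a b c abc0.
have acbc : a * c * b * c * e = 0.
  by rewrite -(mulrA _ b c); apply: annihilator_insert; rewrite mulrA abc0 mul0r.
(* In the square of [a * c * b], drop the last [b]; what remains is [a * c * b * c] with [a]
   inserted before the last [c]. *)
apply: annihilator_sqr; rewrite !mulrA; apply: annihilator_mulr.
exact: annihilator_insert acbc.
Qed.

End KillsSquareZero.

Lemma symmetric_semicommutative (R : pzRingType) (e : R) :
  e_symmetric e -> right_e_semicommutative e.
Proof. by move=> H a b ab0 r; apply: H; rewrite ab0 mul0r. Qed.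

Theorem theorem2p30 (R : pzRingType) (hR : semiprime R) (e : R)
    (he : idempotent_elt e) (he0 : e <> 0) :
  [<-> right_e_reversible e;
       right_e_reduced e;
       e_symmetric e;
       right_e_semicommutative e].
Proof.
tfae.
- move=> /(reversible_kills_square_zero _ _ hR).
  exact: kills_square_zero_reduced.
- move=> /reduced_kills_square_zero.
  exact: kills_square_zero_symmetric.
- exact: symmetric_semicommutative.
- move=> /(semicommutative_kills_square_zero _ _ hR).
  exact: kills_square_zero_reversible.
Qed.
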